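(* Let $k\ge 1$ be an integer and let $G$ be a $k$-STI graph of order $n\ge 5$. Then $$2\le \mathrm{diam}(G)\le \frac{n+k}{2}-1.$$ Moreover, $\mathrm{diam}(G)=2$ if and only if $G\cong K_{\frac{n+k}{2},\frac{n-k}{2}}$.
   Context: All graphs are finite, simple and connected; the order of a graph is its number of vertices, and $\mathrm{diam}(G)$ is the maximum distance between two vertices of $G$. The transmission of a vertex $u$ is $\mathrm{Tr}_G(u)=\sum_{x\in V(G)} d_G(u,x)$, where $d_G$ is the shortest-path distance. For an integer $k\ge 1$, $G$ is a $k$-STI graph if $|\mathrm{Tr}_G(u)-\mathrm{Tr}_G(v)|=k$ for every edge $uv\in E(G)$. $K_{a,b}$ is the complete bipartite graph with parts of sizes $a$ and $b$. *)

(* Defs.v *)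
From mathcomp Require Import all_boot all_order all_algebra.

Set Implicit Arguments.
Unset Strict Implicit.
Unset Printing Implicit Defensive.

Record sgraph := SGraph {
  vertex :> finType;
  adj : rel vertex;
  adj_sym : symmetric adj;
  adj_irrefl : irreflexive adj }.

Definition connected (G : sgraph) : Prop :=
  forall u v : G, connect (@adj G) u v.

Definition has_walk (G : sgraph) (u v : G) (m : nat) : bool :=
  [exists p : m.-tuple G, path (@adj G) u p && (last u p == v)].

(* The least length of a walk from u to v. A shortest walk repeats no vertex,
   so it has fewer than #|G| edges and the search below is exhaustive; the
   default value #|G| is returned only when v is not reachable from u. *)
Definition gdist (G : sgraph) (u v : G) : nat :=
  find (has_walk u v) (iota 0 #|G|).

Definition diam (G : sgraph) : nat := \max_(u : G) \max_(v : G) gdist u v.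

Definition transmission (G : sgraph) (u : G) : nat := \sum_(x : G) gdist u x.

Definition STI (k : nat) (G : sgraph) : Prop :=
  forall u v : G, adj u v ->
    (`|(transmission u)%:Z - (transmission v)%:Z| = k%:Z)%R.

Definition giso (G H : sgraph) : Prop :=
  exists2 f : G -> H, bijective f & {mono f : u v / adj u v}.

Definition bip_rel (a b : nat) : rel ('I_a + 'I_b) := fun x y =>
  match x, y with
  | inl _, inr _ | inr _, inl _ => true
  | _, _ => false
  end.

Fact bip_sym a b : symmetric (@bip_rel a b).
Proof. by move=> [x|x] [y|y]. Qed.

Fact bip_irrefl a b : irreflexive (@bip_rel a b).
Proof. by move=> [x|x]. Qed.

Definition complete_bipartite (a b : nat) : sgraph :=
  SGraph (@bip_sym a b) (@bip_irrefl a b).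

(* Main.v *)
Require Import Defs.
From mathcomp Require Import all_boot all_order all_algebra.
From mathcomp Require Import zify lra.

Set Implicit Arguments.
Unset Strict Implicit.
Unset Printing Implicit Defensive.

(** Transmissions change by exactly [k > 0] along each edge, so the parity of [transmission u %/ k]
    is a proper 2-colouring ([STI_bipartite]). In a bipartite graph no vertex is equidistant from
    the ends of an edge [uv]. Hence [closer u v] and [closer v u] partition the vertices, and their
    sizes differ by the difference of the transmissions, that is by [k]. So they are (n+k)/2 and
    (n-k)/2 in some order ([card_closer]).

    The lower bound holds because two colours exclude triangles. For the upper bound ([diam_le]), a
    geodesic of length d puts d of its vertices into one such set, so d is at most (n+k)/2, and
    equality is refuted by counting the vertices off the geodesic. When the diameter is 2, vertices
    of different colours are at odd distance at most 2, hence adjacent; the graph is then complete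
    bipartite, and the sets [closer u v] give the sizes of its parts. *)

Lemma has_walkP (G : sgraph) (u v : G) m :
  reflect (exists p : seq G, [/\ path (@adj G) u p, last u p = v & size p = m])
          (has_walk u v m).
Proof.
apply: (iffP existsP) => [[p /andP[up /eqP vp]]|[p [up vp sp]]].
  by exists p; rewrite size_tuple.
have sp' : size p == m by apply/eqP.
by exists (Tuple sp'); rewrite /= up vp eqxx.
Qed.

Lemma gdist_le_walk (G : sgraph) (u v : G) m : has_walk u v m -> gdist u v <= m.
Proof.
move=> w; rewrite leqNgt; apply/negP => lt.
(* [find] never exceeds the length of the searched list, so a larger distance forces [m] into the
   searched range. *)
have ltG : m < #|G|.
  by apply: leq_trans lt _; rewrite -[X in _ <= X](size_iota 0) find_size.
by have := before_find 0 lt; rewrite nth_iota // add0n w.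
Qed.

Lemma gdist_path (G : sgraph) (u : G) p :
  path (@adj G) u p -> gdist u (last u p) <= size p.
Proof. by move=> up; apply/gdist_le_walk/has_walkP; exists p. Qed.

Lemma gdistxx (G : sgraph) (u : G) : gdist u u = 0.
Proof. by apply/eqP; rewrite -leqn0; apply: (@gdist_path G u [::]). Qed.

(** * Metric properties of [gdist] and geodesics *)

Section Distance.

Variables (G : sgraph) (G_conn : connected G).
Implicit Types u v w x y z : G.

Lemma gdist_walk u v : has_walk u v (gdist u v).
Proof.
have /connectP[p up ->] := G_conn u v; case: (shortenP up) => q uq Uq _.
have sq : size q < #|G|.
  by rewrite -[size q < _]/(size (u :: q) <= _) -(card_uniqP Uq) max_card.
have hw : has (has_walk u (last u q)) (iota 0 #|G|).
  apply/hasP; exists (size q); first by rewrite mem_iota.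
  by apply/has_walkP; exists q.
have := nth_find 0 hw; rewrite nth_iota // -[X in _ < X](size_iota 0).
by rewrite -has_find.
Qed.

Lemma gdist_geodesic u v :
  exists p, [/\ path (@adj G) u p, last u p = v & size p = gdist u v].
Proof. exact/has_walkP/gdist_walk. Qed.

Lemma gdist_eq0 u v : (gdist u v == 0) = (u == v).
Proof.
apply/eqP/eqP => [d0|->]; last exact: gdistxx.
by have [p [_ + +]] := gdist_geodesic u v; rewrite d0; case: p.
Qed.

Lemma gdist_triangle v u w : gdist u w <= gdist u v + gdist v w.
Proof.
have [p [up vp <-]] := gdist_geodesic u v.
have [q [vq wq <-]] := gdist_geodesic v w.
by rewrite -size_cat -wq -vp -last_cat gdist_path // cat_path up vp.
Qed.

Lemma gdist_le_sym u v : gdist v u <= gdist u v.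
Proof.
have [p [up vp <-]] := gdist_geodesic u v.
have := @gdist_path G (last u p) (rev (belast u p)).
rewrite rev_path -(eq_path (e := @adj G)); last by move=> x y; rewrite adj_sym.
rewrite up size_rev size_belast vp => /(_ isT).
suff -> : last v (rev (belast u p)) = u by [].
by case: p vp {up} => [|x p] /= vp; rewrite ?vp // rev_cons last_rcons.
Qed.

Lemma gdistC u v : gdist u v = gdist v u.
Proof. by apply/eqP; rewrite eqn_leq !gdist_le_sym. Qed.

Lemma gdist_eq1 u v : (gdist u v == 1) = adj u v.
Proof.
apply/eqP/idP => [d1|uv].
  have [p [+ + +]] := gdist_geodesic u v; rewrite d1.
  by case: p => [|x [|]] //= /andP[+ _] <-.
apply/eqP; rewrite eqn_leq lt0n gdist_eq0.
have -> /= : gdist u v <= 1 by apply: (@gdist_path G u [:: v]); rewrite /= uv.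
by apply: contraL uv => /eqP->; rewrite adj_irrefl.
Qed.

Lemma gdist_adj u v x : adj u v -> gdist u x <= (gdist v x).+1.
Proof. by rewrite -gdist_eq1 => /eqP uv; rewrite -add1n -uv gdist_triangle. Qed.

Lemma geodesic u v : exists f : nat -> G,
  [/\ f 0 = u, f (gdist u v) = v &
      forall i j, i <= j <= gdist u v -> gdist (f i) (f j) = j - i].
Proof.
have [p [up vp sp]] := gdist_geodesic u v.
exists (nth u (u :: p)); set f := nth _ _.
have f0 : f 0 = u by [].
have fd : f (gdist u v) = v by rewrite -sp -vp (last_nth u).
have f_adj i : i < gdist u v -> adj (f i) (f i.+1).
  by rewrite -sp => /(pathP u up).
have f_le i m : i + m <= gdist u v -> gdist (f i) (f (i + m)) <= m.
  elim: m => [|m IH] lim; first by rewrite addn0 gdistxx.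
  have := gdist_triangle (f (i + m)) (f i) (f (i + m.+1)).
  have /eqP -> : gdist (f (i + m)) (f (i + m.+1)) == 1.
    by rewrite gdist_eq1 addnS f_adj //; lia.
  by have := IH ltac:(lia); lia.
split=> // i j ij.
(* The three stretches u to [f i], [f i] to [f j], [f j] to v have upper bounds summing to
   [gdist u v]; by the triangle inequality none of them is strict. *)
have := f_le 0 i; have := f_le i (j - i); have := f_le j (gdist u v - j).
rewrite !subnKC ?add0n ?f0 ?fd; try lia.
have := gdist_triangle (f i) u v; have := gdist_triangle (f j) (f i) v.
lia.
Qed.

(** A discrete intermediate value argument: along a geodesic from [x] to [v] the distance from [z]
    changes by at most one per step, so no level is skipped. *)
Lemma geodesic_level z x v j : gdist z x <= j <= gdist z v ->
  exists2 w, gdist z w = j & gdist x w + gdist w v = gdist x v.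
Proof.
move: {2}(gdist x v) (erefl (gdist x v)) => m.
elim: m x => [|m IH] x dm zxv.
  move/eqP: dm; rewrite gdist_eq0 => /eqP xv; rewrite xv in zxv *.
  by exists v; rewrite ?gdistxx //; lia.
have [zx|zx] := eqVneq (gdist z x) j; first by exists x; rewrite ?gdistxx.
have [f [f0 fm fd]] := geodesic x v; rewrite dm in fm fd.
have xf1 : gdist x (f 1) = 1 by rewrite -f0 fd.
have f1v : gdist (f 1) v = m by rewrite -fm fd ?leqnn ?subn1.
have := gdist_triangle x z (f 1); rewrite xf1 => zf1.
have [|w zw wv] := IH _ f1v; first by lia.
exists w => //; have := gdist_triangle (f 1) x w.
have := gdist_triangle w x v; lia.
Qed.

Lemma gdist_le_diam u v : gdist u v <= diam G.
Proof.
by apply: leq_trans (leq_bigmax u); apply: (leq_bigmax (F := gdist u)).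
Qed.

Lemma diam_attained : 0 < #|G| -> exists u v, gdist u v = diam G.
Proof.
move=> G0; have [u du] := eq_bigmax (fun u => \max_(v : G) gdist u v) G0.
by have [v dv] := eq_bigmax (gdist u) G0; exists u, v; rewrite /diam du dv.
Qed.

(** * Edges and distances in a graph with a proper 2-colouring [c] *)

Definition closer u v : {set G} := [set x | gdist u x < gdist v x].

Variables (c : G -> bool) (c_adj : forall u v, adj u v -> c v = ~~ c u).

Lemma odd_gdist u v : odd (gdist u v) = c u (+) c v.
Proof.
have [p [up <- <-]] := gdist_geodesic u v.
elim: p u up => [|x p IH] u /=; first by rewrite addbb.
by case/andP=> /c_adj cx /IH ->; rewrite cx addNb negbK.
Qed.

Lemma gdist_adj_neq u v x : adj u v -> gdist u x != gdist v x.
Proof.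
move=> /c_adj uv; apply/eqP => /(congr1 odd); rewrite !odd_gdist uv.
by case: (c u) (c x) => [] [].
Qed.

Lemma closerC u v : adj u v -> closer v u = ~: closer u v.
Proof.
move=> uv; apply/setP => x; rewrite !inE -leqNgt ltn_neqAle eq_sym.
by rewrite gdist_adj_neq.
Qed.

(** The equality holds term by term: the distances from any [x] to [u] and to [v] differ by exactly
    one, and the indicator of the nearer end makes up for it. *)
Lemma transmission_closer u v : adj u v ->
  transmission u + #|closer u v| = transmission v + #|closer v u|.
Proof.
have cE y z : #|closer y z| = \sum_(x : G) (gdist y x < gdist z x).
  rewrite -sum1_card big_mkcond; apply: eq_bigr => x _.
  by rewrite inE; case: ifP.
move=> uv; rewrite !cE -!big_split /=; apply: eq_bigr => x _.
have := gdist_adj x uv.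
have := gdist_adj_neq x uv; rewrite adj_sym in uv; have := gdist_adj x uv.
by case: ltngtP; lia.
Qed.

End Distance.

(** * Consequences of the k-STI condition *)

Lemma STI_transmission k (G : sgraph) (u v : G) : STI k G -> adj u v ->
  transmission u = transmission v + k \/ transmission v = transmission u + k.
Proof. move=> G_STI /G_STI; lia. Qed.

(* Along an edge [transmission _ %/ k] changes by exactly one. *)
Lemma STI_bipartite k (G : sgraph) : 0 < k -> STI k G ->
  exists c : G -> bool, forall u v, adj u v -> c v = ~~ c u.
Proof.
move=> k0 G_STI; exists (fun u => odd (transmission u %/ k)) => u v uv.
by have [] := STI_transmission G_STI uv => ->;
  rewrite divnDr ?dvdnn // divnn k0 addn1 /= ?negbK.
Qed.

Lemma card_closer k (G : sgraph) (u v : G) : connected G -> 0 < k -> STI k G ->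
  adj u v -> 2 * #|closer u v| = #|G| + k \/ 2 * #|closer u v| + k = #|G|.
Proof.
move=> G_conn k0 G_STI uv; have [c c_adj] := STI_bipartite k0 G_STI.
have := transmission_closer G_conn c_adj uv.
rewrite (closerC G_conn c_adj uv); have := cardsC (closer u v).
by have := STI_transmission G_STI uv; lia.
Qed.

(** * Bounds on the diameter *)

(** With diameter at most 1, any three vertices would form a triangle, which two colours cannot
    colour properly. *)
Lemma diam_ge2 (G : sgraph) (c : G -> bool) : connected G -> 2 < #|G| ->
  (forall u v, adj u v -> c v = ~~ c u) -> 2 <= diam G.
Proof.
move=> G_conn /card_gt2P[x [y [z [_ [xy yz zx]]]]] c_adj.
rewrite leqNgt; apply/negP => d1.
have adjT (u v : G) : u != v -> adj u v.
  move=> uv; rewrite -gdist_eq1 // eqn_leq lt0n gdist_eq0 // uv andbT.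
  by apply: leq_trans (gdist_le_diam u v) _.
have := c_adj _ _ (adjT _ _ xy); have := c_adj _ _ (adjT _ _ yz).
by have := c_adj _ _ (adjT _ _ zx); case: (c x) (c y) (c z) => [] [] [].
Qed.

(* Suppose the path [u_0, ..., u_d] is geodesic with [2 d >= n + k]. Counting
   forces [closer u_1 u_0 = {u_1, ..., u_d}] and, symmetrically,
   [closer u_(d-1) u_d = {u_0, ..., u_(d-1)}]. If some [x] is off the path then
   no level [1, ..., d - 1] from [u_0] reduces to its path vertex, since that
   vertex would separate [x] from [u_0] or from [u_d]; this produces [d - 1]
   off-path vertices, too many. If all vertices are on the path, then
   [closer u_1 u_2 = {u_0, u_1}] has the wrong size. *)
Lemma diam_le k (G : sgraph) : connected G -> 0 < k -> STI k G -> 4 < #|G| ->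
  2 * diam G + 2 <= #|G| + k.
Proof.
move=> G_conn k0 G_STI n5; have [c c_adj] := STI_bipartite k0 G_STI.
have d2 := diam_ge2 G_conn (ltac:(lia) : 2 < #|G|) c_adj.
have [u [v]] := diam_attained (ltac:(lia) : 0 < #|G|).
have [f [_ _]] := geodesic G_conn u v => /[swap] ->; move: (diam G) d2 => d d2.
move=> fd; have fd' i j : j <= i <= d -> gdist (f i) (f j) = i - j.
  by move=> ij; rewrite gdistC // fd.
have f_adj i : i < d -> adj (f i) (f i.+1).
  by move=> id; rewrite -gdist_eq1 // fd ?subSnn //; lia.
have f_inj i j : i <= d -> j <= d -> f i = f j -> i = j.
  move=> id jd fij; have := gdistxx (f i); rewrite {2}fij.
  by case: (leqP i j) => ij; [rewrite fd | rewrite fd']; lia.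
have adj01 := f_adj 0 (ltac:(lia)).
have adjd : adj (f d.-1) (f d).
  by have := f_adj d.-1; rewrite prednK; [apply|]; lia.
rewrite leqNgt; apply/negP => d_large.
pose P1 := [set f i.+1 | i : 'I_d]; pose P2 := [set f i | i : 'I_d].
pose P := [set f i | i : 'I_d.+1].
have cP1 : #|P1| = d.
  rewrite card_imset ?card_ord // => i j /f_inj => /(_ (ltn_ord i) (ltn_ord j)).
  by move=> [] /val_inj.
have cP2 : #|P2| = d.
  rewrite card_imset ?card_ord // => i j /f_inj.
  by move=> /(_ (ltnW (ltn_ord i)) (ltnW (ltn_ord j))) /val_inj.
have cP : #|P| = d.+1.
  rewrite card_imset ?card_ord // => i j /f_inj.
  by move=> /(_ (ltn_ord i) (ltn_ord j)) /val_inj.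
have P1s : P1 \subset closer (f 1) (f 0).
  apply/subsetP => _ /imsetP[i _ ->].
  by rewrite inE !fd; have := ltn_ord i; lia.
have P2s : P2 \subset closer (f d.-1) (f d).
  apply/subsetP => _ /imsetP[i _ ->].
  by rewrite inE !fd'; have := ltn_ord i; lia.
have adj10 : adj (f 1) (f 0) by rewrite adj_sym.
have W1 := card_closer G_conn k0 G_STI adj10.
have W2 := card_closer G_conn k0 G_STI adjd.
have := subset_leq_card P1s; have := subset_leq_card P2s.
rewrite cP1 cP2 => le2 le1.
(* [closer (f 1) (f 0)] has at least d elements and at most (n+k)/2 < d + 1, hence exactly d. *)
have eq1 : P1 = closer (f 1) (f 0).
  by apply/eqP; rewrite eqEcard P1s cP1; lia.
have eq2 : P2 = closer (f d.-1) (f d).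
  by apply/eqP; rewrite eqEcard P2s cP2; lia.
have cG : 2 * d = #|G| + k by rewrite -cP1 eq1; move: W1; rewrite -eq1 cP1; lia.
(* Off the path, [x] lies in neither closer set; as ties are impossible, it is strictly nearer to
   each end of the path than to the neighbour of that end. *)
have offP x : x \notin P ->
    gdist (f 0) x < gdist (f 1) x /\ gdist (f d) x < gdist (f d.-1) x.
  move=> xP; have xP1 : x \notin P1.
    apply: contra xP => /imsetP[i _ ->]; apply/imsetP.
    by exists (lift ord0 i).
  have xP2 : x \notin P2.
    apply: contra xP => /imsetP[i _ ->]; apply/imsetP.
    by exists (widen_ord (leqnSn d) i).
  have := gdist_adj_neq G_conn c_adj x adj01.
  have := gdist_adj_neq G_conn c_adj x adjd.
  by move: xP1 xP2; rewrite eq1 eq2 !inE; lia.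
have [PT|] := eqVneq P setT.
  have W3 := card_closer G_conn k0 G_STI (f_adj 1 d2).
  have cGd : #|G| = d.+1 by rewrite -cP PT cardsT.
  have eq3 : closer (f 1) (f 2) = [set f 0; f 1].
    apply/setP => y; have : y \in P by rewrite PT inE.
    case/imsetP => -[i /= id] _ ->; rewrite !inE.
    case: i id => [|[|i]] id.
    - by rewrite !fd' ?eqxx //; lia.
    - by rewrite gdistxx fd' ?eqxx ?orbT //; lia.
    rewrite !fd ?subSS ?subn0; try lia.
    rewrite ltnNge leqnSn; apply/esym/norP.
    by split; apply/eqP => /f_inj; lia.
  have c01 : f 0 != f 1 by apply/eqP => /f_inj; lia.
  (* Here n = d + 1 and 2d = n + k give n = k + 2, so size 2 is possible only for k = 1 and n = 3,
     which [n5] excludes. *)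
  by rewrite eq3 cards2 c01 in W3; lia.
rewrite -subTset => /subsetPn[x _ xP]; have [x0 xd] := offP x xP.
have level j : 0 < j < d -> exists2 y, y \notin P & gdist (f 0) y = j.
  move=> jd; have only y : gdist (f 0) y = j -> y \in P -> y = f j.
    move=> yj /imsetP[i _ yi]; move: yj; rewrite yi fd ?subn0 => [->//|].
    by have := ltn_ord i; lia.
  have [xj|jx] := leqP (gdist (f 0) x) j.
    have x_j_d : gdist (f 0) x <= j <= gdist (f 0) (f d) by rewrite xj fd; lia.
    have [w w0 wd] := geodesic_level G_conn (x := x) x_j_d.
    exists w => //; apply/negP => /(only _ w0) wj.
    (* A geodesic from [x] to [f d] through [f j] could be taken through [f d.-1], against [xd]. The
       other case is symmetric, with [f 1] and [x0]. *)
    have := gdist_triangle G_conn (f j) x (f d.-1).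
    by move: xd wd; rewrite wj !(gdistC G_conn _ x) !fd; lia.
  have z_j_x : gdist (f 0) (f 0) <= j <= gdist (f 0) x by rewrite gdistxx; lia.
  have [w w0 wd] := geodesic_level G_conn (x := f 0) z_j_x.
  exists w => //; apply/negP => /(only _ w0) wj.
  have := gdist_triangle G_conn (f j) (f 1) x.
  by move: wd; rewrite wj !fd; lia.
(* Different levels give different vertices, so at least d - 1 lie off the path; but n - d - 1 = d -
   1 - k is smaller. *)
have : size (iota 1 d.-1) <= size [seq gdist (f 0) y | y <- enum (~: P)].
  apply: uniq_leq_size (iota_uniq _ _) _ => j; rewrite mem_iota => jd.
  have [|y yP <-] := level j; first by lia.
  by apply: map_f; rewrite mem_enum inE.
by rewrite size_iota size_map -cardE; have := cardsC P; lia.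
Qed.

(** * Complete bipartite graphs and diameter two *)

(** The elements [u] and [v] serve as the defaults that [enum_rank_in] requires for numbering the
    two parts. *)
Lemma giso_complete_bipartite (G : sgraph) (A : {set G}) u v :
  u \in A -> v \notin A ->
  (forall x y, adj x y = ((x \in A) != (y \in A))) ->
  giso G (complete_bipartite #|A| #|~: A|).
Proof.
move=> uA vA adjE; have vA' : v \in ~: A by rewrite inE.
pose f x : 'I_#|A| + 'I_#|~: A| :=
  if x \in A then inl (enum_rank_in uA x) else inr (enum_rank_in vA' x).
exists f.
  apply: inj_card_bij; last by rewrite card_sum !card_ord cardsC.
  move=> x y; rewrite /f; case: ifPn => xA; case: ifPn => yA // [].
    exact: enum_rank_in_inj.
  by apply: enum_rank_in_inj; rewrite inE.
by move=> x y; rewrite adjE /f; case: (x \in A) (y \in A) => [] [].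
Qed.

Lemma diam_complete_bipartite (G : sgraph) a b : connected G ->
  giso G (complete_bipartite a b) -> 0 < b <= a -> diam G <= 2.
Proof.
move=> G_conn [f [g fK gK] f_adj] /andP[b0 ba].
have a0 := leq_trans b0 ba.
have gd (x y : G) : gdist x y <= 2.
  have walk z : adj x z -> adj z y -> gdist x y <= 2.
    by move=> xz zy; apply: (@gdist_path G x [:: z; y]); rewrite /= xz zy.
  have walk1 : adj x y -> gdist x y <= 2.
    by rewrite -gdist_eq1 // => /eqP ->.
  case fx: (f x) => [i|i]; case fy: (f y) => [j|j].
  - by apply: (walk (g (inr (Ordinal b0)))); rewrite -f_adj gK ?fx ?fy.
  - by apply: walk1; rewrite -f_adj fx fy.
  - by apply: walk1; rewrite -f_adj fx fy.
  - by apply: (walk (g (inl (Ordinal a0)))); rewrite -f_adj gK ?fx ?fy.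
by apply/bigmax_leqP => x _; apply/bigmax_leqP => y _.
Qed.

Theorem theorem2p4 (k n : nat) (G : sgraph) (k_ge1 : (1 <= k)%N)
    (G_conn : connected G) (G_STI : STI k G) (G_order : #|G| = n)
    (n_ge5 : (5 <= n)%N) :
  [/\ (2 <= diam G)%N,
      ((diam G)%:R <= (n + k)%:R / 2 - 1 :> rat)%R &
      diam G = 2%N <->
      exists a b : nat, [/\ (2 * a = n + k)%N, (2 * b + k = n)%N &
                            giso G (complete_bipartite a b)]].
Proof.
subst n; have [c c_adj] := STI_bipartite k_ge1 G_STI.
have diam2 := diam_ge2 G_conn (ltac:(lia) : 2 < #|G|) c_adj.
have diam_up := diam_le G_conn k_ge1 G_STI n_ge5.
(* Any edge works once suitably oriented: its two closer sets are complementary, so one of them has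
   the larger size. *)
have [u [v [uv W]]] : exists u v : G, adj u v /\ 2 * #|closer u v| = #|G| + k.
  have [x [y dxy]] := diam_attained (ltac:(lia) : 0 < #|G|).
  have [f [_ _ fd]] := geodesic G_conn x y; rewrite dxy in fd.
  have xy : adj (f 0) (f 1) by rewrite -gdist_eq1 // fd ?subn0 //; lia.
  have yx : adj (f 1) (f 0) by rewrite adj_sym.
  have := card_closer G_conn k_ge1 G_STI xy.
  have := card_closer G_conn k_ge1 G_STI yx.
  have := cardsC (closer (f 0) (f 1)).
  rewrite -(closerC G_conn c_adj xy) => sumW [] W1 [] W2;
    by [exists (f 0), (f 1); split | exists (f 1), (f 0); split | lia].
split=> //.
  have : ((2 * diam G + 2)%:R <= (#|G| + k)%:R :> rat)%R.
    by rewrite Num.Theory.ler_nat.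
  by rewrite GRing.natrD GRing.natrM; lra.
have vu : adj v u by rewrite adj_sym.
have W' := closerC G_conn c_adj uv; have sumW := cardsC (closer u v).
(* This complement has (n-k)/2 elements, so the smaller part [b] below is positive. *)
have vW : 0 < #|~: closer u v|.
  by apply/card_gt0P; exists v; rewrite -W' inE gdistxx // lt0n gdist_eq0 //;
     apply: contraL vu => /eqP ->; rewrite adj_irrefl.
split=> [d2|[a [b [ak bk iso]]]]; last first.
  apply/eqP; rewrite eqn_leq diam2 andbT.
  by apply: diam_complete_bipartite iso _ => //; lia.
(* The colour class of [v] is the larger part: at diameter 2, [closer u v] is this class with [v]
   exchanged for [u]. *)
pose A := [set x | c x == c v].
have adjE x y : adj x y = ((x \in A) != (y \in A)).
  apply/idP/idP => [/c_adj xy|].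
    by rewrite !inE xy; case: (c x) (c v) => [] [].
  rewrite !inE => xy; have : odd (gdist x y).
    by rewrite (odd_gdist G_conn c_adj); move: xy; case: (c x) (c y) (c v) => [] [] [].
  have := gdist_le_diam x y; rewrite d2 -gdist_eq1 //.
  by case: (gdist x y) => [|[|[|]]].
have cA : #|A| = #|closer u v|.
  have vA : v \in A by rewrite inE.
  have uW : u \notin A :\ v.
    by rewrite !inE (c_adj _ _ uv); case: (c u); rewrite andbF.
  have -> : closer u v = u |: (A :\ v).
    apply/setP => x; rewrite !inE.
    have [->|xu] := eqVneq x u.
      rewrite gdistxx lt0n gdist_eq0 //=.
      by apply: contraL uv => /eqP ->; rewrite adj_irrefl.
    have [->|xv] := eqVneq x v; first by rewrite gdistxx.
    have := odd_gdist G_conn c_adj u x; have := odd_gdist G_conn c_adj v x.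
    have := gdist_le_diam u x; have := gdist_le_diam v x.
    rewrite d2 (c_adj _ _ uv).
    move: (gdist_eq0 G_conn u x) (gdist_eq0 G_conn v x).
    rewrite ![_ == x]eq_sym (negPf xu) (negPf xv).
    case: (gdist u x) (gdist v x) => [|[|[|]]] // [|[|[|]]] //;
      by case: (c u) (c x) => [] [].
  by rewrite cardsU1 uW (cardsD1 v A) vA.
exists #|A|, #|~: A|; have := cardsC A; rewrite cA => sumA.
split; [by [] | lia |].
rewrite -cA; apply: (@giso_complete_bipartite _ _ v u) adjE.
  by rewrite inE.
by rewrite inE (c_adj _ _ uv); case: (c u).
Qed.
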